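(* Let $Q(x,\xi)=\min\{q^Tz : Wz=h(\xi)-T(\xi)x,\ z\ge 0\}$ for $x\in X$, $\xi\in\Xi$, where the vector $q$ and the matrix $W$ do not depend on $\xi$. Assume: - (relatively complete recourse) for all $x\in X$ and $\xi\in\Xi$, the second-stage problem defining $Q(x,\xi)$ is feasible; - (bounded dual feasible region) the set $\{\pi : W^T\pi\le q\}$ is bounded; - (bounded first-stage decisions) $\sup_{x\in X}\|x\|\le r$. Let $M_\pi=\sup\{\|\pi\| : W^T\pi\le q\}$ and $$c_{LP}(\xi,\xi')=M_\pi\left[\|h(\xi)-h(\xi')\|+r\,\|T(\xi)-T(\xi')\|\right],$$ and assume that $c_{LP}:\Xi\times\Xi\to[0,+\infty]$ is measurable, lower semicontinuous and not identically $+\infty$. Then for all $\xi,\xi'\in\Xi$, $$R(\xi,\xi'):=\sup_{x\in X}[Q(x,\xi)-Q(x,\xi')]\le c_{LP}(\xi,\xi').$$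
   Context: $X\subseteq\mathbb R^{n_1}$ is closed and nonempty, $\Xi\subseteq\mathbb R^d$, $q\in\mathbb R^{n_2}$, $W\in\mathbb R^{m\times n_2}$, $h:\Xi\to\mathbb R^m$ and $T:\Xi\to\mathbb R^{m\times n_1}$. Inequalities between vectors are componentwise. The norm $\|\cdot\|$ is the Euclidean norm on vectors and the induced operator norm on matrices. The minimum defining $Q(x,\xi)$ is attained, so $Q$ is real-valued on $X\times\Xi$. *)

(* Defs.v *)
From HB Require Import structures.
From mathcomp Require Import all_boot all_order all_algebra.
From mathcomp Require Import all_classical all_reals all_analysis.
From mathcomp Require Import measurable_realfun.

Set Implicit Arguments.
Unset Strict Implicit.
Unset Printing Implicit Defensive.

Import Order.TTheory GRing.Theory Num.Theory.
Import numFieldNormedType.Exports.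

Local Open Scope classical_set_scope.
Local Open Scope ring_scope.

(** The library norm [`|x|] on ['cV[R]_n] is the max norm, hence a separate
    Euclidean norm (the topology on matrices is the same for both). *)
Definition enorm (R : realType) (n : nat) (x : 'cV[R]_n) : R :=
  Num.sqrt (\sum_(i < n) x i 0 ^+ 2).

Definition opnorm (R : realType) (m n : nat) (A : 'M[R]_(m, n)) : R :=
  sup [set enorm (A *m x) | x in [set x : 'cV[R]_n | enorm x <= 1]].

Definition vle (R : realType) (n : nat) (x y : 'cV[R]_n) : Prop :=
  forall i : 'I_n, x i 0 <= y i 0.

Definition vdot (R : realType) (n : nat) (x y : 'cV[R]_n) : R :=
  (x^T *m y) 0 0.

Section TwoStage.
Context (R : realType) (d m n1 n2 : nat).
Implicit Types (x : 'cV[R]_n1) (xi : 'cV[R]_d) (q z : 'cV[R]_n2).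
Variables (X : set 'cV[R]_n1) (q : 'cV[R]_n2) (W : 'M[R]_(m, n2)).
(** [h] and [T] are total functions on [R^d]; the hypotheses and the conclusion
    of the theorem only involve their values on the support [Xi]. *)
Variables (h : 'cV[R]_d -> 'cV[R]_m) (T : 'cV[R]_d -> 'M[R]_(m, n1)).

Definition second_stage_feasible x xi : set 'cV[R]_n2 :=
  [set z | W *m z = h xi - T xi *m x /\ vle 0 z].

Definition second_stage_attained x xi : Prop :=
  exists2 z, second_stage_feasible x xi z &
    forall z', second_stage_feasible x xi z' -> vdot q z <= vdot q z'.

(** This real infimum is the minimum of the second-stage problem as soon as
    [second_stage_attained x xi] holds. *)
Definition recourse x xi : R :=
  inf [set vdot q z | z in second_stage_feasible x xi].

Definition dual_feasible : set 'cV[R]_m := [set pi | vle (W^T *m pi) q].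

Definition dual_radius : \bar R :=
  ereal_sup [set (enorm pi)%:E | pi in dual_feasible].

Definition cLP (r : R) xi xi' : \bar R :=
  (dual_radius *
     (enorm (h xi - h xi') + r * opnorm (T xi - T xi'))%:E)%E.

Definition regret xi xi' : \bar R :=
  ereal_sup [set (recourse x xi - recourse x xi')%:E | x in X].

End TwoStage.

(** Borel sigma-algebra of the topological subspace [D]; no measurability of
    [D] in the ambient space is required. *)
Definition subspace_borel (S : topologicalType) (D : set S) : set (set S) :=
  <<s D, [set D `&` U | U in [set U : set S | open U]] >>.

Definition borel_measurable_on (R : realType) (S : topologicalType) (D : set S)
    (f : S -> \bar R) : Prop :=
  forall B : set (\bar R), measurable B -> subspace_borel D (D `&` f @^-1` B).

(** The topology of [subspace D] is the relative one at the points of [D] and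
    discrete outside, so only the restriction of [f] to [D] matters. *)
Definition lower_semicontinuous_on (R : realType) (S : topologicalType)
    (D : set S) (f : S -> \bar R) : Prop :=
  lower_semicontinuous (f : subspace D -> \bar R).

(* Main.v *)
Require Import Defs.
From HB Require Import structures.
From mathcomp Require Import all_boot all_order all_algebra.
From mathcomp Require Import all_classical all_reals all_analysis.
From mathcomp Require Import measurable_realfun.
From mathcomp Require Import ring lra.
Import Order.TTheory GRing.Theory Num.Theory.
Import numFieldNormedType.Exports.
Local Open Scope classical_set_scope.
Local Open Scope ring_scope.

(** The second-stage problem is a linear program whose dual feasible region
    [{pi : W^T pi <= q}] does not depend on the scenario.  Let [pi] be optimal
    for the dual of the problem at [(x, xi)]: strong duality gives
    [Q(x, xi) = pi^T (h xi - T xi x)].  The same [pi] is feasible for the dual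
    of the problem at [(x, xi')], where weak duality gives
    [Q(x, xi') >= pi^T (h xi' - T xi' x)].  Subtracting,
    [Q(x, xi) - Q(x, xi')
       <= pi^T (h xi - h xi') - pi^T ((T xi - T xi') x)],
    and Cauchy-Schwarz together with [enorm pi <= M_pi] and [enorm x <= r]
    bounds the right-hand side by [c_LP] ([recourse_diff_le]).

    Strong duality ([lp_dual_exists]) is derived from the Farkas lemma
    ([farkas]), whose proof is algebraic: it goes by induction on the number of
    inequalities and needs neither convex separation nor the closedness of
    finitely generated cones. *)

Set Implicit Arguments.
Unset Strict Implicit.
Unset Printing Implicit Defensive.

(** * The Farkas lemma *)

(** Bartl's induction on the number of inequalities.  If the first inequality
    [a x <= 0] cannot be dropped, some [x0] satisfies all the others, with
    [0 < g x0], hence [0 < a x0]; normalise [a x0 = 1].  Projecting along [x0]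
    onto the hyperplane [a x = 0] removes the first inequality, so that the
    induction hypothesis applies to the projected rows and functional. *)
Lemma farkas (F : realFieldType) (n m : nat) (A : 'M[F]_(n, m)) (g : 'rV[F]_m) :
  (forall x : 'cV[F]_m, (forall i, (A *m x) i 0 <= 0) -> (g *m x) 0 0 <= 0) ->
  exists2 u : 'rV[F]_n, (forall i, 0 <= u 0 i) & g = u *m A.
Proof.
elim: n A g => [|n IHn] A g gA.
  exists 0 => [[]//|]; apply/rowP => j; rewrite mul0mx mxE.
  have ge_j s : s * g 0 j <= 0.
    have /gA : forall i, (A *m (s *: delta_mx j 0 : 'cV[F]_m)) i 0 <= 0 by case.
    by rewrite -scalemxAr mxE -colE mxE.
  by have := ge_j 1; have := ge_j (-1); lra.
pose a : 'rV[F]_m := usubmx (A : 'M[F]_(1 + n, m)).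
pose B : 'M[F]_(n, m) := dsubmx (A : 'M[F]_(1 + n, m)).
have mulA p (C : 'M[F]_(m, p)) :
    A *m C = col_mx (a *m C) (B *m C) :> 'M[F]_(1 + n, p).
  by rewrite -mul_col_mx vsubmxK.
have rowsA (x : 'cV[F]_m) : (a *m x) 0 0 <= 0 ->
    (forall i, (B *m x) i 0 <= 0) -> forall i, (A *m x) i 0 <= 0.
  move=> ax Bx i; rewrite mulA mxE.
  by case: (fintype.split _) => // k; rewrite (ord1 k).
have combA (t : F) (u : 'rV[F]_n) :
    (row_mx t%:M u : 'rV[F]_(1 + n)) *m (A : 'M[F]_(1 + n, m)) = t *: a + u *m B.
  by rewrite -[A in _ *m A](@vsubmxK F 1 n m) mul_row_col mul_scalar_mx.
have [gB|] := pselect (forall x : 'cV[F]_m,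
    (forall i, (B *m x) i 0 <= 0) -> (g *m x) 0 0 <= 0).
  have [u u0 ->] := IHn B g gB.
  exists (row_mx 0%:M u : 'rV[F]_(1 + n)); last by rewrite combA scale0r add0r.
  by move=> i; rewrite mxE; case: (fintype.split _) => // k; rewrite !mxE mul0rn.
move=> /existsNP[y /not_implyP[By /negP]]; rewrite -ltNge => gy.
have ay : 0 < (a *m y) 0 0.
  rewrite ltNge; apply/negP => ay; have := gA y (rowsA y ay By).
  by rewrite leNgt gy.
pose x0 := ((a *m y) 0 0)^-1 *: y.
have ax0 : a *m x0 = 1%:M.
  apply/matrixP => i j; rewrite !ord1 -scalemxAr mxE mulVf ?gt_eqF//.
  by rewrite !mxE.
have Bx0 i : (B *m x0) i 0 <= 0.
  by rewrite -scalemxAr mxE pmulr_rle0 ?invr_gt0.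
have gx0 : 0 < (g *m x0) 0 0 by rewrite -scalemxAr mxE mulr_gt0 ?invr_gt0.
have [x|u u0 gE] := IHn (B - B *m x0 *m a) (g - g *m x0 *m a).
  (* [x - x0 (a x)] is the projection of [x] along [x0] *)
  have projE p (C : 'M[F]_(p, m)) :
      (C - C *m x0 *m a) *m x = C *m (x - x0 *m (a *m x)).
    by rewrite mulmxBl mulmxBr !mulmxA.
  rewrite !projE => Bx; apply: gA; apply: rowsA => //.
  by rewrite mulmxBr mulmxA ax0 mul1mx subrr mxE.
(* the coefficient of [a] once the projection is expanded in [gE] *)
pose t := (g *m x0) 0 0 - (u *m (B *m x0)) 0 0.
exists (row_mx t%:M u : 'rV[F]_(1 + n)).
  move=> i; rewrite mxE; case: (fintype.split _) => // k.
  rewrite (ord1 k) mxE eqxx mulr1n subr_ge0; apply: le_trans (ltW gx0).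
  by rewrite mxE sumr_le0// => j _; rewrite mulr_ge0_le0.
rewrite combA -mul_scalar_mx.
have -> : t%:M = g *m x0 - u *m (B *m x0).
  by rewrite [RHS]mx11_scalar [in RHS]mxE [X in _ + X]mxE.
rewrite [LHS](canRL (subrK _) gE) mulmxBr mulmxBl !mulmxA.
by rewrite -addrA [LHS]addrC [- _ + _]addrC.
Qed.

(** The form of the Farkas lemma dual to systems [M x = 0, x >= 0], obtained by
    writing each equation as two inequalities. *)
Lemma farkas_eq (F : realFieldType) (n m : nat) (M : 'M[F]_(m, n))
    (g : 'rV[F]_n) :
  (forall x : 'cV[F]_n, M *m x = 0 -> (forall j, 0 <= x j 0) ->
     (g *m x) 0 0 <= 0) ->
  exists y : 'rV[F]_m, forall j, g 0 j <= (y *m M) 0 j.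
Proof.
move=> gM.
have [x Ax|u u0 ->] := @farkas F _ n (col_mx (col_mx M (- M)) (- 1%:M)) g.
  have Mx i : (M *m x) i 0 <= 0.
    by have := Ax (lshift n (lshift m i)); rewrite !mul_col_mx !col_mxEu.
  have MNx i : 0 <= (M *m x) i 0.
    have := Ax (lshift n (rshift m i)).
    by rewrite !mul_col_mx col_mxEu col_mxEd mulNmx mxE oppr_le0.
  apply: gM => [|j].
    by apply/colP => i; rewrite [RHS]mxE; apply/le_anti; rewrite Mx MNx.
  have := Ax (rshift (m + m) j).
  by rewrite mul_col_mx col_mxEd mulNmx mul1mx mxE oppr_le0.
pose v := lsubmx u; exists (lsubmx v - rsubmx v) => j.
rewrite -[u]hsubmxK -/v -[v in row_mx v _]hsubmxK !mul_row_col.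
rewrite !mulmxN mulmx1 mulmxBl [leLHS]mxE gerDl.
by rewrite !mxE oppr_le0 u0.
Qed.

(** * Linear programming duality *)

Section LinearProgramming.
Context (R : realType) (m n : nat).
Implicit Types (q z : 'cV[R]_n) (W : 'M[R]_(m, n)) (b pi : 'cV[R]_m).

Lemma vle0P z : vle 0 z <-> forall j, 0 <= z j 0.
Proof. by split=> z0 j; have := z0 j; rewrite [(0 : 'cV[R]_n) j 0]mxE. Qed.

(** The inequality [W^T *m pi <= q] is preserved by pairing with [z >= 0], and
    pairing [W^T *m pi] with [z] is pairing [pi] with [W *m z = b]. *)
Lemma lp_weak_duality q W b pi z :
  dual_feasible q W pi -> W *m z = b -> vle 0 z -> vdot pi b <= vdot q z.
Proof.
move=> piq <- z0; rewrite /vdot mulmxA -[pi^T *m W]trmxK trmx_mul trmxK.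
rewrite !mxE; apply: ler_sum => j _.
rewrite ler_wpM2r//; first by have /vle0P := z0; apply.
by rewrite mxE [leRHS]mxE; exact: piq.
Qed.

(** Strong duality.  The Farkas lemma is applied to the homogenised system
    [W v = t b, v >= 0, t >= 0], on which [t (vdot q z) <= vdot q v]: for
    [t > 0], [t^-1 v] is feasible, and for [t = 0], [z + v] is feasible; both
    are compared with the optimal [z].  The multiplier it returns is [- pi^T]. *)
Lemma lp_dual_exists q W b z :
  W *m z = b -> vle 0 z ->
  (forall z', W *m z' = b -> vle 0 z' -> vdot q z <= vdot q z') ->
  exists2 pi, dual_feasible q W pi & vdot q z <= vdot pi b.
Proof.
move=> Wz z0 zopt.
have [x|y gy] := @farkas_eq R _ m
    (row_mx W (- b)) (row_mx (- q^T) (vdot q z)%:M).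
  rewrite -[x]vsubmxK; set v := usubmx x; set s := dsubmx x.
  rewrite !mul_row_col mulNmx => /eqP; rewrite subr_eq0 => /eqP Wv x0.
  have v0 j : 0 <= v j 0 by have := x0 (lshift 1 j); rewrite col_mxEu.
  have s0 : 0 <= s 0 0 by have := x0 (rshift n 0); rewrite col_mxEd.
  rewrite [s in b *m s]mx11_scalar mul_mx_scalar in Wv.
  rewrite mulNmx mul_scalar_mx [leLHS]mxE [X in X + _]mxE [X in _ + X]mxE.
  rewrite -/(vdot q v) addrC subr_le0 mulrC.
  move: s0; rewrite le_eqVlt => /predU1P[s0|s0].
    have := zopt (z + v); rewrite mulmxDr Wz Wv -s0 scale0r addr0 => /(_ erefl).
    rewrite /vdot mulmxDr [X in _ <= X]mxE lerDl mul0r; apply.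
    by apply/vle0P => j; have /vle0P z0j := z0; rewrite mxE addr_ge0.
  have := zopt ((s 0 0)^-1 *: v).
  rewrite -scalemxAr Wv scalerA mulVf ?gt_eqF// scale1r => /(_ erefl).
  rewrite /vdot -scalemxAr [X in _ <= X]mxE ler_pdivlMl//; apply.
  by apply/vle0P => j; rewrite mxE mulr_ge0// invr_ge0 ltW.
exists (- y^T) => [j|].
  have := gy (lshift 1 j); rewrite mul_mx_row !row_mxEl mulmxN -trmx_mul.
  by rewrite !mxE lerNl.
have := gy (rshift n 0); rewrite mul_mx_row !row_mxEr mulmxN.
by rewrite /vdot linearN/= trmxK mulNmx [leLHS]mxE eqxx mulr1n.
Qed.

End LinearProgramming.

(** * Euclidean and operator norms *)

Section EuclideanNorm.
Context {R : realType}.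

Lemma enorm_ge0 n (x : 'cV[R]_n) : 0 <= enorm x.
Proof. exact: sqrtr_ge0. Qed.

Lemma sqr_enorm n (x : 'cV[R]_n) : enorm x ^+ 2 = \sum_i x i 0 ^+ 2.
Proof. by rewrite sqr_sqrtr// sumr_ge0// => i _; exact: sqr_ge0. Qed.

Lemma enorm0 n : enorm (0 : 'cV[R]_n) = 0.
Proof. by rewrite /enorm big1 ?sqrtr0// => i _; rewrite mxE expr0n. Qed.

Lemma enorm0_eq0 n (x : 'cV[R]_n) : enorm x = 0 -> x = 0.
Proof.
move=> x0; apply/colP => i; rewrite mxE; apply/eqP.
have /eqP := sqr_enorm x; rewrite x0 expr0n/= eq_sym psumr_eq0; last first.
  by move=> j _; exact: sqr_ge0.
by move=> /allP/(_ i); rewrite mem_index_enum sqrf_eq0 => /(_ isT).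
Qed.

Lemma enormZ n (a : R) (x : 'cV[R]_n) : enorm (a *: x) = `|a| * enorm x.
Proof.
rewrite /enorm -sqrtr_sqr -sqrtrM ?sqr_ge0// mulr_sumr.
by congr Num.sqrt; apply: eq_bigr => i _; rewrite mxE exprMn.
Qed.

Lemma vdot_sum n (x y : 'cV[R]_n) : vdot x y = \sum_i x i 0 * y i 0.
Proof. by rewrite /vdot mxE; apply: eq_bigr => i _; rewrite mxE. Qed.

Lemma vdotBr n (x y z : 'cV[R]_n) : vdot x (y - z) = vdot x y - vdot x z.
Proof. by rewrite /vdot mulmxBr [LHS]mxE [X in _ + X]mxE. Qed.

(** The sum of the squares of [|y| x_i - |x| y_i] equals
    [2 |x| |y| (|x| |y| - x.y)], where the factor in front of the parentheses
    can be divided out once [x] and [y] are nonzero. *)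
Lemma vdot_le_enorm n (x y : 'cV[R]_n) : vdot x y <= enorm x * enorm y.
Proof.
have [x0|x0] := eqVneq (enorm x) 0.
  rewrite x0 mul0r (enorm0_eq0 x0) vdot_sum big1// => i _.
  by rewrite mxE mul0r.
have [y0|y0] := eqVneq (enorm y) 0.
  rewrite y0 mulr0 (enorm0_eq0 y0) vdot_sum big1// => i _.
  by rewrite mxE mulr0.
have xy0 : 0 < enorm x * enorm y by rewrite mulr_gt0// lt0r ?x0 ?y0 enorm_ge0.
have : 0 <= \sum_i (enorm y * x i 0 - enorm x * y i 0) ^+ 2.
  by rewrite sumr_ge0// => i _; exact: sqr_ge0.
have -> : \sum_i (enorm y * x i 0 - enorm x * y i 0) ^+ 2 =
    enorm x * enorm y * (2 * (enorm x * enorm y - vdot x y)).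
  transitivity (enorm y ^+ 2 * (\sum_i x i 0 ^+ 2)
      + enorm x ^+ 2 * (\sum_i y i 0 ^+ 2)
      - 2 * enorm x * enorm y * vdot x y); last by rewrite -!sqr_enorm; ring.
  rewrite vdot_sum !mulr_sumr -sumrN -!big_split/=.
  by apply: eq_bigr => i _; ring.
by rewrite !pmulr_rge0// subr_ge0.
Qed.

Lemma normr_vdot_le n (x y : 'cV[R]_n) : `|vdot x y| <= enorm x * enorm y.
Proof.
rewrite ler_norml vdot_le_enorm andbT lerNl.
have -> : - vdot x y = vdot ((-1) *: x) y.
  by rewrite /vdot linearZ/= -scalemxAl scaleN1r [RHS]mxE.
by rewrite (le_trans (vdot_le_enorm _ _))// enormZ normrN1 mul1r.
Qed.

(** Applying Cauchy-Schwarz to each row bounds the set by the Frobenius norm of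
    [A]; its role is to make the supremum [opnorm A] a genuine one, since [sup]
    takes the value [0] on unbounded sets. *)
Lemma enorm_mulmx_bounded m n (A : 'M[R]_(m, n)) :
  has_ubound [set enorm (A *m x) | x in [set x : 'cV[R]_n | enorm x <= 1]].
Proof.
exists (Num.sqrt (\sum_i enorm (row i A)^T ^+ 2)) => _ [x /= x1 <-].
apply: ler_wsqrtr; apply: ler_sum => i _.
have -> : (A *m x) i 0 = vdot (row i A)^T x.
  by rewrite /vdot trmxK -row_mul [RHS]mxE.
rewrite -[leLHS]real_normK ?num_real//.
rewrite lerXn2r ?nnegrE ?enorm_ge0//.
by rewrite (le_trans (normr_vdot_le _ _))// ler_piMr// enorm_ge0.
Qed.

Lemma opnorm_ge0 m n (A : 'M[R]_(m, n)) : 0 <= opnorm A.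
Proof.
apply: ub_le_sup; first exact: enorm_mulmx_bounded.
by exists 0; rewrite /= ?mulmx0 enorm0.
Qed.

Lemma enorm_mulmx_le m n (A : 'M[R]_(m, n)) (x : 'cV[R]_n) :
  enorm (A *m x) <= opnorm A * enorm x.
Proof.
have [x0|x0] := eqVneq (enorm x) 0.
  by rewrite (enorm0_eq0 x0) mulmx0 !enorm0 mulr0.
have xgt0 : 0 < enorm x by rewrite lt0r x0 enorm_ge0.
rewrite -ler_pdivrMr// mulrC.
apply: ub_le_sup; first exact: enorm_mulmx_bounded.
exists ((enorm x)^-1 *: x); rewrite /= -?scalemxAr enormZ gtr0_norm ?invr_gt0//.
by rewrite mulVf.
Qed.

End EuclideanNorm.

(** * The regret bound *)

Section Regret.
Context (R : realType) (d m n1 n2 : nat).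
Variables (q : 'cV[R]_n2) (W : 'M[R]_(m, n2)).
Variables (h : 'cV[R]_d -> 'cV[R]_m) (T : 'cV[R]_d -> 'M[R]_(m, n1)).

Lemma recourse_attainedE x xi z :
  second_stage_feasible W h T x xi z ->
  (forall z', second_stage_feasible W h T x xi z' -> vdot q z <= vdot q z') ->
  recourse q W h T x xi = vdot q z.
Proof.
move=> zf zmin; apply/eqP; rewrite eq_le; apply/andP; split.
  by apply: ge_inf; [exists (vdot q z) => _ [z' /zmin ? <-]|exists z].
by apply: lb_le_inf; [exists (vdot q z), z|move=> _ [z' /zmin ? <-]].
Qed.

(** [pi] is an optimal dual solution at [xi]; as the dual constraints do not
    involve the scenario, it also bounds the recourse at [xi'] from below. *)
Lemma recourse_diff_le x xi xi' :
  second_stage_attained q W h T x xi -> second_stage_attained q W h T x xi' ->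
  exists2 pi, dual_feasible q W pi &
    recourse q W h T x xi - recourse q W h T x xi' <=
    enorm pi * (enorm (h xi - h xi') + opnorm (T xi - T xi') * enorm x).
Proof.
move=> [z [Wz z0] zmin] [z' [Wz' z'0] z'min].
have [pi pif zpi] := lp_dual_exists Wz z0
  (fun y Wy y0 => zmin y (conj Wy y0)).
exists pi => //.
rewrite (recourse_attainedE (conj Wz z0) zmin).
rewrite (recourse_attainedE (conj Wz' z'0) z'min).
apply: le_trans (lerB zpi (lp_weak_duality pif Wz' z'0)) _.
have -> : vdot pi (h xi - T xi *m x) - vdot pi (h xi' - T xi' *m x) =
    vdot pi (h xi - h xi') - vdot pi ((T xi - T xi') *m x).
  by rewrite mulmxBl !vdotBr; ring.
rewrite mulrDr lerD ?vdot_le_enorm//.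
apply: le_trans (ler_norm _) _; rewrite normrN.
apply: le_trans (normr_vdot_le _ _) _.
by rewrite ler_wpM2l ?enorm_ge0// enorm_mulmx_le.
Qed.

End Regret.

Unset Implicit Arguments.
Set Strict Implicit.

Theorem proposition5p3 (R : realType) (d m n1 n2 : nat)
    (X : set 'cV[R]_n1) (Xi : set 'cV[R]_d)
    (q : 'cV[R]_n2) (W : 'M[R]_(m, n2))
    (h : 'cV[R]_d -> 'cV[R]_m) (T : 'cV[R]_d -> 'M[R]_(m, n1)) (r : R)
    (c := fun p : 'cV[R]_d * 'cV[R]_d => cLP q W h T r p.1 p.2) :
  closed X -> X !=set0 ->
  (* the minimum defining Q is attained *)
  (forall x xi, X x -> Xi xi -> second_stage_attained q W h T x xi) ->
  (* relatively complete recourse *)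
  (forall x xi, X x -> Xi xi -> second_stage_feasible W h T x xi !=set0) ->
  (* bounded dual feasible region *)
  has_ubound [set enorm pi | pi in dual_feasible q W] ->
  (* bounded first-stage decisions *)
  (ereal_sup [set (enorm x)%:E | x in X] <= r%:E)%E ->
  (* c_LP : Xi x Xi -> [0, +oo] is measurable, l.s.c., not identically +oo *)
  (forall p, (Xi `*` Xi) p -> (0 <= c p)%E) ->
  borel_measurable_on (Xi `*` Xi) c ->
  lower_semicontinuous_on (Xi `*` Xi) c ->
  (exists2 p, (Xi `*` Xi) p & c p != +oo%E) ->
  forall xi xi', Xi xi -> Xi xi' ->
    (regret X q W h T xi xi' <= cLP q W h T r xi xi')%E.
Proof.
move=> _ _ Qmin _ _ Xr _ _ _ _ xi xi' Xi_xi Xi_xi'.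
apply: ge_ereal_sup => _ [x Xx <-].
have xr : enorm x <= r.
  by rewrite -lee_fin; apply: le_trans Xr; apply: ereal_sup_ubound; exists x.
have [pi pif Qpi] :=
  recourse_diff_le (Qmin x xi Xx Xi_xi) (Qmin x xi' Xx Xi_xi').
set K := enorm (h xi - h xi') + r * opnorm (T xi - T xi').
have K0 : 0 <= K.
  rewrite addr_ge0 ?enorm_ge0// mulr_ge0 ?opnorm_ge0//.
  exact: le_trans (enorm_ge0 x) xr.
apply: (@le_trans _ _ ((enorm pi)%:E * K%:E)%E).
  rewrite -EFinM lee_fin (le_trans Qpi)// ler_wpM2l ?enorm_ge0//.
  by rewrite lerD2l mulrC ler_wpM2r ?opnorm_ge0.
apply: lee_wpmul2r; first by rewrite lee_fin.
by apply: ereal_sup_ubound; exists pi.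
Qed.
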